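(* For every integer $k\ge 0$ and every graph $G$ (possibly infinite), if every finite subgraph of $G$ has path-width at most $k$, then $G$ has line-width at most $k$.
   Context: Graphs have no loops or parallel edges, and may be infinite. A path-decomposition of a finite graph $G$ is a finite sequence $(B_1,\ldots,B_n)$ of subsets of $V(G)$ such that: (i) for each vertex $v$ of $G$ there exists $i\in\{1,\ldots,n\}$ with $v\in B_i$; (ii) for each edge $uv$ of $G$ there exists $i\in\{1,\ldots,n\}$ with $u,v\in B_i$; (iii) for each vertex $v$ of $G$ and all $i,i',i''\in\{1,\ldots,n\}$ with $i\le i'\le i''$, if $v\in B_i\cap B_{i''}$ then $v\in B_{i'}$. Its width is the maximum of $|B_i|-1$ over $i\in\{1,\ldots,n\}$, and the path-width of a finite graph is the minimum width of a path-decomposition of it. A line is a set with a linear order $<$. A line-decomposition of a graph $G$ is a family $(B_i : i\in L)$, where $L$ is a line and each $B_i$ is a subset of $V(G)$, such that: (i) for each vertex $v$ of $G$ there exists $i\in L$ with $v\in B_i$; (ii) for each edge $uv$ of $G$ there exists $i\in L$ with $u,v\in B_i$; (iii) for each vertex $v$ of $G$ and all $i,i',i''\in L$ with $i\le i'\le i''$, if $v\in B_i\cap B_{i''}$ then $v\in B_{i'}$. The width of a line-decomposition is the maximum of $|B_i|-1$ over all $i\in L$, if this maximum exists, and the line-width of $G$ is the minimum width of a line-decomposition of $G$. Thus $G$ has line-width at most $k$ if and only if it has a line-decomposition $(B_i : i\in L)$ in which every $B_i$ is finite with $|B_i|\le k+1$. *)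

(* Defs.v *)
From mathcomp Require Import all_boot all_order all_algebra.
From mathcomp Require Import boolp classical_sets functions cardinality.

Set Implicit Arguments.
Unset Strict Implicit.
Unset Printing Implicit Defensive.

Import Order.TTheory GRing.Theory Num.Theory.

Local Open Scope classical_set_scope.
Local Open Scope card_scope.

(* A simple graph whose vertices are the elements of a possibly infinite
   (possibly empty) set [vertices] of elements of an arbitrary type [T]; the
   ambient type lets a graph and its subgraphs be compared directly. *)
Record graph (T : Type) := Graph {
  vertices : set T;
  adj : T -> T -> Prop;
  adj_sym : forall u v, adj u v -> adj v u;
  adj_irrefl : forall v, ~ adj v v;
  adj_vertices : forall u v, adj u v -> vertices u /\ vertices v
}.

Definition subgraph (T : Type) (H G : graph T) : Prop :=
  vertices H `<=` vertices G /\ (forall u v, adj H u v -> adj G u v).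

Definition finite_graph (T : Type) (G : graph T) : Prop :=
  finite_set (vertices G).

(* With [L] an arbitrary [orderType] this is a line-decomposition; with [L]
   the ordinal type ['I_n] it is a path-decomposition. *)
Definition decomposition (T : Type) (G : graph T)
    (d : Order.disp_t) (L : orderType d) (B : L -> set T) : Prop :=
  [/\ forall i, B i `<=` vertices G,
      forall v, vertices G v -> exists i, B i v,
      forall u v, adj G u v -> exists i, B i u /\ B i v
    & forall v (i i' i'' : L), vertices G v ->
        (i <= i' <= i'')%O -> B i v -> B i'' v -> B i' v].

(* [w] is the maximum of |B i| - 1; in particular every [B i] is finite. The
   width is an [int], since it is -1 when all the bags are empty. There is no
   such [w] when [I] is empty or when the bags have no finite maximum size. *)
Definition has_width (T I : Type) (B : I -> set T) (w : int) : Prop :=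
  exists n : nat, [/\ w = (n%:Z - 1)%R,
    exists i, B i #= `I_n & forall i, B i #<= `I_n].

Definition path_widths (T : Type) (G : graph T) : set int :=
  [set w | exists (n : nat) (B : 'I_n -> set T),
     decomposition G B /\ has_width B w].

Definition line_widths (T : Type) (G : graph T) : set int :=
  [set w | exists (d : Order.disp_t) (L : orderType d) (B : L -> set T),
     decomposition G B /\ has_width B w].

Definition is_minimum (A : set int) (w : int) : Prop := A w /\ lbound A w.

Definition path_width_le (T : Type) (G : graph T) (k : nat) : Prop :=
  exists w : int, is_minimum (path_widths G) w /\ (w <= k%:Z)%R.

Definition line_width_le (T : Type) (G : graph T) (k : nat) : Prop :=
  exists w : int, is_minimum (line_widths G) w /\ (w <= k%:Z)%R.

(* Main.v *)
(** Break ties between first bags to turn a path-decomposition into a linear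
    order of the vertices by left endpoint, together with the relation "[u]
    lies in the first bag containing [v]". All the properties of this pair of
    relations are universal, so an ultraproduct over the finite vertex sets
    transfers them from the finite subgraphs to the whole graph. The vertices
    themselves, in the limit order, then index a line-decomposition. *)

From HB Require Import structures.
Require Import Defs.
From mathcomp Require Import all_boot all_order all_algebra.
From mathcomp Require Import boolp classical_sets functions cardinality.
From mathcomp Require Import filter zify.

Set Implicit Arguments.
Unset Strict Implicit.
Unset Printing Implicit Defensive.

Local Open Scope classical_set_scope.
Local Open Scope card_scope.

(** * Preliminaries on finite sets and filters *)

Lemma prop_ex_minn (P : nat -> Prop) :
  (exists n, P n) -> exists n, P n /\ forall m, P m -> (n <= m)%N.
Proof.
move=> [n0 Pn0]; have exP : exists n, `[< P n >] by exists n0; apply/asboolP.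
case: (ex_minnP exP) => n /asboolP Pn n_min; exists n; split=> // m Pm.
by apply: n_min; apply/asboolP.
Qed.

Lemma finite_injective_nat (T : Type) (S : set T) :
  finite_set S ->
  exists f : T -> nat, forall u v, S u -> S v -> f u = f v -> u = v.
Proof.
move=> [n]; rewrite card_eq_le => /andP[/pcard_leP[f] _].
by exists f => u v Su Sv fuv; apply: (@inj _ _ _ f) => //; apply: mem_set.
Qed.

(** An infinite [A] would contain a finite subset with more than [n] elements. This lets the bag
    size bound be tested on finite sets only. *)
Lemma card_le_finite_subsets (T : Type) (A : set T) (n : nat) :
  (forall F, finite_set F -> F `<=` A -> F #<= `I_n) -> A #<= `I_n.
Proof.
elim/Pchoice: T => T in A *; move=> An.
have [fA|infA] := pselect (finite_set A); first exact: An.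
have [X XA ltnX] := infinite_set_fset n.+1 infA.
have /geq_card_fset_set := An _ (finite_fset X) XA.
by rewrite set_fsetK leqNgt ltnX.
Qed.

Lemma filter_finite_forall (T I : Type) (U : set_system I) (D : set T)
    (P : T -> set I) :
  Filter U -> finite_set D -> (forall x, D x -> U (P x)) ->
  U [set i | forall x, D x -> P x i].
Proof.
move=> FU; elim/Pchoice: T => T in D P * => /finite_fsetP[X ->] UP.
exact: (filter_bigI (f := P)).
Qed.

(** * Layouts of finite graphs *)

(* [le] orders the vertices by left endpoint, and [C u v] says that [u] lies
   in the bag placed at the left endpoint of [v]. *)
Record layout (T : Type) (E : T -> T -> Prop) (k : nat) (S : set T)
    (le C : T -> T -> Prop) : Prop := Layout {
  layout_anti : forall u v, S u -> S v -> le u v -> le v u -> u = v;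
  layout_trans : forall u v w, S u -> S v -> S w ->
    le u v -> le v w -> le u w;
  layout_total : forall u v, S u -> S v -> le u v \/ le v u;
  layout_refl : forall v, S v -> C v v;
  layout_le : forall u v, S u -> S v -> C u v -> le u v;
  layout_between : forall u v w, S u -> S v -> S w ->
    le u v -> le v w -> C u w -> C u v;
  layout_adj : forall u v, S u -> S v -> E u v -> C u v \/ C v u;
  layout_card : forall v, S v -> [set u | S u /\ C u v] #<= `I_k
}.

Lemma layout_of_path (T : Type) (H : graph T) (k n : nat)
    (B : 'I_n -> set T) :
  finite_graph H -> decomposition H B -> (forall i, B i #<= `I_k) ->
  exists le C, layout (adj H) k (vertices H) le C.
Proof.
move=> finH [BH Bcov Badj Bint] Bk.
have [f f_inj] := finite_injective_nat finH.
(* Bag membership is indexed by naturals, so that the first bag index [l] can be a total function,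
   with junk value 0 off [H]. *)
pose b m v := exists2 j : 'I_n, j = m :> nat & B j v.
have /choice[l lP] v : exists m, vertices H v ->
    b m v /\ forall m', b m' v -> (m <= m')%N.
  have [Hv|//] := pselect (vertices H v); last by exists 0.
  have [i Biv] := Bcov v Hv.
  have [|m ?] := @prop_ex_minn (b^~ v); first by exists i, i.
  by exists m.
have b_between v i j m : vertices H v -> (i <= m <= j)%N ->
    b i v -> b j v -> b m v.
  move=> Hv /andP[im mj] [i' ei Bi] [j' ej Bj]; have mn : (m < n)%N.
    by apply: leq_ltn_trans mj _; rewrite -ej.
  exists (Ordinal mn) => //; apply: (Bint v i' _ j') => //.
  by rewrite !leEord /= ei ej im mj.
pose le u v := (l u < l v)%N \/ l u = l v /\ (f u <= f v)%N.
have le_l u v : le u v -> (l u <= l v)%N by rewrite /le; lia.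
(* The conjunct [le u v] discards those [u] with the same first bag as [v] that lose the
   tie-break. *)
exists le, (fun u v => le u v /\ b (l v) u); split.
- by move=> u v Su Sv uv vu; apply: f_inj => //; move: uv vu; rewrite /le; lia.
- by move=> u v w _ _ _; rewrite /le; lia.
- by move=> u v _ _; rewrite /le; lia.
- by move=> v /lP[bv _]; split=> //; right.
- by move=> u v _ _ [].
- move=> u v w Hu Hv Hw uv vw [uw bwu]; split=> //.
  have [bu _] := lP u Hu; apply: b_between bu bwu => //.
  by rewrite !le_l.
(* If bag [i] contains both ends, then [l u <= l v <= i], so [u] lies in bag [l v] by convexity. *)
- have wlg u v : vertices H u -> vertices H v -> adj H u v -> le u v ->
      b (l v) u.
    move=> Hu Hv /Badj[i [Biu Biv]] /le_l luv.
    have [bu _] := lP u Hu; have [_ lv] := lP v Hv.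
    apply: (b_between u (l u) i) => //; last by exists i.
    by rewrite luv lv //; exists i.
  move=> u v Hu Hv uv; have [le_uv|le_vu] : le u v \/ le v u by rewrite /le; lia.
    by left; split=> //; apply: wlg.
  by right; split=> //; apply: wlg => //; apply: adj_sym.
- move=> v Hv; have [[i il Biv] _] := lP v Hv.
  apply: card_le_trans (Bk i); apply: subset_card_le => u [_ [_ [j jl Bju]]].
  by have -> : i = j by apply/val_inj; rewrite /= il jl.
Qed.

(** * Compactness by an ultrafilter on finite vertex sets *)

Lemma layout_compact (T : Type) (E : T -> T -> Prop) (k : nat) (V : set T) :
  (forall S, finite_set S -> S `<=` V -> exists le C, layout E k S le C) ->
  exists le C, layout E k V le C.
Proof.
move=> finV.
have /choice[le /choice[C lay]] S : exists le C,
    finite_set S -> S `<=` V -> layout E k S le C.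
  have [[fS SV]|nS] := pselect (finite_set S /\ S `<=` V).
    by have [le [C]] := finV S fS SV; exists le, C.
  by exists (fun _ _ => True), (fun _ _ => True) => ? ?; case: nS.
pose D : set (set T) := [set F | finite_set F /\ F `<=` V].
(* The intersection of [above F] and [above G] contains [above] of their union, and [F] itself lies
   in [above F], so these sets generate a proper filter. An ultrafilter extending it makes any given
   vertex of [V] lie in [U]-many [S]. *)
pose above F : set (set T) := [set S | D S /\ F `<=` S].
have : ProperFilter (filter_from D above).
  apply: filter_from_proper => [|F DF]; last by exists F; split.
  apply: filter_from_filter; first by exists set0; split.
  move=> F G [fF FV] [fG GV]; exists (F `|` G).
    by split; [rewrite finite_setU | rewrite subUset].
  by move=> S [DS]; rewrite subUset => -[FS GS]; split; split.
move=> /ultraFilterLemma[U [UU subU]].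
have PU : ProperFilter U := @ultra_proper _ _ UU.
have U_mem v : V v -> U [set S | S v].
  move=> Vv; apply: subU; exists [set v]; first by split=> // _ ->.
  by move=> S [_ vS]; apply: vS.
have U_lay u v w : V u -> V v -> V w ->
    U [set S | layout E k S (le S) (C S) /\ [/\ S u, S v & S w]].
  move=> Vu Vv Vw; apply: filterI.
    apply: subU; exists set0; first by split.
    by move=> S [[fS SV] _]; apply: lay.
  by apply: filterS3 (U_mem u Vu) (U_mem v Vv) (U_mem w Vw) => S.
(* Totality and the edge axiom have disjunctive conclusions, which a mere filter would not split. *)
have U_or A B : U (A `|` B) -> U A \/ U B.
  move=> UAB; have [|UnA] := in_ultra_setVsetC A UU; [by left|right].
  by apply: filterS2 UAB UnA => S [].
exists (fun u v => U [set S | le S u v]), (fun u v => U [set S | C S u v]).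
split.
(* The equality [u = v] does not mention [S], so it is enough to prove it for [U]-many [S]. *)
- move=> u v Vu Vv Uuv Uvu; apply: (@filter_const _ U).
  apply: filterS3 Uuv Uvu (U_lay u v v Vu Vv Vv) => S uv vu [L [? ? _]].
  exact: (layout_anti L).
- move=> u v w Vu Vv Vw Uuv Uvw.
  apply: filterS3 Uuv Uvw (U_lay u v w Vu Vv Vw) => S uv vw [L [? ? ?]].
  exact: (layout_trans L (v := v)).
- move=> u v Vu Vv; apply: U_or.
  apply: filterS (U_lay u v v Vu Vv Vv) => S [L [? ? _]].
  exact: (layout_total L).
- move=> v Vv; apply: filterS (U_lay v v v Vv Vv Vv) => S [L [? _ _]].
  exact: (layout_refl L).
- move=> u v Vu Vv UC.
  apply: filterS2 UC (U_lay u v v Vu Vv Vv) => S Cuv [L [? ? _]].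
  exact: (layout_le L).
- move=> u v w Vu Vv Vw Uuv Uvw UC.
  apply: filterS3 (filterI Uuv Uvw) UC (U_lay u v w Vu Vv Vw).
  by move=> S [? ?] ? [L [? ? ?]]; apply: (layout_between L (w := w)).
- move=> u v Vu Vv Euv; apply: U_or.
  apply: filterS (U_lay u v v Vu Vv Vv) => S [L [? ? _]].
  exact: (layout_adj L).
(* For finite [F], the finitely many conditions hold at once for [U]-many [S]; in any such [S] that
   also contains [v], [F] lies in a set of size at most [k]. *)
- move=> v Vv; apply: card_le_finite_subsets => F finF FC.
  apply: (@filter_const _ U).
  have UF : U [set S | forall u, F u -> S u /\ C S u v].
    apply: (filter_finite_forall (P := fun u => [set S | S u /\ C S u v])) => //.
    by move=> u /FC[Vu UC]; apply: filterS2 (U_mem u Vu) UC.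
  apply: filterS2 UF (U_lay v v v Vv Vv Vv) => S FS [L [Sv _ _]].
  exact: card_le_trans (subset_card_le FS) (layout_card L Sv).
Qed.

(** * From a layout to a line-decomposition *)

Lemma has_width_le (T I : Type) (B : I -> set T) (k : nat) :
  (exists i : I, True) -> (forall i, B i #<= `I_k) ->
  exists2 n, (n <= k)%N & has_width B (n%:Z - 1)%R.
Proof.
move=> [i0 _] Bk.
have [|n [Bn n_min]] := @prop_ex_minn (fun n => forall i, B i #<= `I_n).
  by exists k.
exists n; first exact: n_min.
exists n; split=> //; apply: contrapT => nBn.
have ltB i : exists2 m, (m < n)%N & B i #= `I_m.
  have [m Bm] : finite_set (B i) by apply/finite_set_leP; exists n.
  exists m => //; rewrite ltn_neqAle -card_le_II -(card_le_eql Bm) Bn andbT.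
  by apply/negP => /eqP emn; apply: nBn; exists i; rewrite -emn.
(* Positivity makes [n.-1] a strictly smaller bound, contradicting the minimality of [n]. *)
have n_gt0 : (0 < n)%N by have [m] := ltB i0; case: (n).
suff : (n <= n.-1)%N by lia.
apply: n_min => i; have [m ltmn Bm] := ltB i.
by rewrite (card_le_eql Bm) card_le_II; lia.
Qed.

Lemma line_width_le_decomposition (T : Type) (G : graph T) (k : nat)
    (d : Order.disp_t) (L : orderType d) (B : L -> set T) :
  (exists i : L, True) -> decomposition G B -> (forall i, B i #<= `I_k.+1) ->
  line_width_le G k.
Proof.
move=> L0 decB Bk; have [n lenk Bn] := has_width_le L0 Bk.
have [|m [Gm m_min]] :=
    @prop_ex_minn (fun m => line_widths G (m%:Z - 1)%R).
  by exists n, d, L, B.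
exists (m%:Z - 1)%R; split; last first.
  have /m_min : line_widths G (n%:Z - 1)%R by exists d, L, B.
  by lia.
split=> // w Gw; have [_ [_ [_ [_ [n' [ew _ _]]]]]] := Gw.
by move: Gw; rewrite ew => /m_min; lia.
Qed.

(** Indexing by vertices would give an empty line, which has no width; a single empty bag is used
    instead. *)
Lemma line_width_le_empty (T : Type) (G : graph T) (k : nat) :
  ~ (exists v, vertices G v) -> line_width_le G k.
Proof.
move=> G0; apply: (@line_width_le_decomposition _ _ _ _ 'I_1 (fun=> set0)).
- by exists ord0.
- split=> [i v []|v Gv|u v uv|v i j m Gv].
  + by case: G0; exists v.
  + by case: G0; exists u; have [] := adj_vertices uv.
  + by case: G0; exists v.
- by move=> _; apply: card_ge0.
Qed.

Lemma line_width_le_layout (T : Type) (G : graph T) (k : nat)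
    (le C : T -> T -> Prop) :
  (exists v, vertices G v) -> layout (adj G) k.+1 (vertices G) le C ->
  line_width_le G k.
Proof.
move=> [v0 Gv0] lay.
pose V := {v : T | vertices G v}.
pose leV (u v : V) : bool := `[< le (sval u) (sval v) >].
have leV_refl : reflexive leV.
  by case=> v Gv; apply/asboolP; have [] := layout_total lay Gv Gv.
have leV_anti : antisymmetric leV.
  case=> u Gu [v Gv] /andP[/asboolP /= uv /asboolP /= vu].
  exact/eq_exist/(layout_anti lay).
have leV_trans : transitive leV.
  case=> u Gu [v Gv] [w Gw] /asboolP /= uv /asboolP /= vw; apply/asboolP => /=.
  exact: (layout_trans lay (v := u)).
have leV_total : total leV.
  case=> u Gu [v Gv]; have [uv|vu] := layout_total lay Gu Gv.
    by apply/orP; left; apply/asboolP.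
  by apply/orP; right; apply/asboolP.
(* As [T] is an arbitrary type, equality and choice on [V] are the classical ones. *)
pose eqV := gen_eqMixin V.
pose chV := gen_choiceMixin V.
pose cV : choiceType := HB.pack V eqV chV.
pose pV := @Order.Le_isPOrder.Build (Order.Disp tt tt) cV leV
  leV_refl leV_anti leV_trans.
pose poV : porderType (Order.Disp tt tt) := HB.pack (Choice.sort cV) pV.
pose tV := @Order.POrder_isTotal.Build (Order.Disp tt tt) poV leV_total.
pose L : orderType (Order.Disp tt tt) := HB.pack (Order.POrder.sort poV) tV.
pose B (i : L) : set T := [set u | vertices G u /\ C u (sval (i : V))].
apply: (@line_width_le_decomposition _ _ _ _ L B).
- by exists (exist _ v0 Gv0).
- split=> [i v []//|v Gv|u v uv|v i j m Gv /andP[ij jm] [_ vi] [_ vm]].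
  + by exists (exist _ v Gv); split=> //; apply: (layout_refl lay).
  + have [Gu Gv] := adj_vertices uv.
    have [Cuv|Cvu] := layout_adj lay Gu Gv uv.
    * by exists (exist _ v Gv); split; split=> //; apply: (layout_refl lay).
    * by exists (exist _ u Gu); split; split=> //; apply: (layout_refl lay).
  (* From [C v i] comes [le v i], hence [le v j]; together with [le j m] and [C v m] this gives
     [C v j]. *)
  + case: i j m => i Gi [j Gj] [m Gm] /= in ij jm vi vm *.
    have {}ij : le i j by apply: (asboolW ij).
    have {}jm : le j m by apply: (asboolW jm).
    split=> //=; apply: (layout_between lay _ _ Gm) => //.
    exact: (layout_trans lay _ Gi) (layout_le lay _ _ vi) ij.
- by case=> v Gv; apply: (layout_card lay).
Qed.

(** * Induced subgraphs and the conclusion *)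

Definition induced_adj (T : Type) (G : graph T) (S : set T) (u v : T) : Prop :=
  [/\ adj G u v, S u & S v].

Lemma induced_adj_sym (T : Type) (G : graph T) (S : set T) (u v : T) :
  induced_adj G S u v -> induced_adj G S v u.
Proof. by case=> uv Su Sv; split=> //; apply: adj_sym. Qed.

Lemma induced_adj_irrefl (T : Type) (G : graph T) (S : set T) (v : T) :
  ~ induced_adj G S v v.
Proof. by case=> vv _ _; apply: adj_irrefl vv. Qed.

Lemma induced_adj_vertices (T : Type) (G : graph T) (S : set T) (u v : T) :
  induced_adj G S u v -> S u /\ S v.
Proof. by case. Qed.

Definition induced (T : Type) (G : graph T) (S : set T) : graph T :=
  Graph (@induced_adj_sym T G S) (@induced_adj_irrefl T G S)
        (@induced_adj_vertices T G S).

Theorem mainTheorem6 (k : nat) (T : Type) (G : graph T) :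
  (forall H : graph T, subgraph H G -> finite_graph H -> path_width_le H k) ->
  line_width_le G k.
Proof.
move=> pwG.
have [G0|G0] := pselect (exists v, vertices G v); last first.
  exact: line_width_le_empty.
suff [le [C lay]] : exists le C, layout (adj G) k.+1 (vertices G) le C.
  exact: line_width_le_layout lay.
apply: layout_compact => S finS SG.
have [|w [[[n [B [decB [m [ew _ Bm]]]]] _] wk]] := pwG (induced G S) _ finS.
  by split=> // u v [].
have Bk i : B i #<= `I_k.+1.
  by apply: card_le_trans (Bm i) _; rewrite card_le_II; lia.
have [le [C lay]] := @layout_of_path _ (induced G S) _ _ _ finS decB Bk.
(* Only the edge axiom mentions the graph, and [G] and [induced G S] have the same edges within
   [S]. *)
exists le, C; case: lay => ? ? ? ? ? ? lay_adj ?; split=> // u v Su Sv uv.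
exact: lay_adj.
Qed.
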